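(* Let $x \geq 0$ be a real number. For each positive integer $n$, let $B_n(x) = \sum_{k=1}^n \frac1k \left\lfloor \frac{k}{n}x \right\rfloor$. Then $$\lim_{n \to \infty} B_n(x) = \sum_{k = 1}^{\lfloor x \rfloor} \log(x / k).$$
   Context: $\lfloor t \rfloor$ denotes the greatest integer less than or equal to $t$, and $\log$ is the natural logarithm. An empty sum equals $0$. *)

(* Defs.v *)
From mathcomp Require Import all_boot all_order all_algebra.
From mathcomp Require Import all_classical all_reals all_analysis.

Set Implicit Arguments.
Unset Strict Implicit.
Unset Printing Implicit Defensive.

Import Order.TTheory GRing.Theory Num.Theory.
Import numFieldNormedType.Exports.
Local Open Scope ring_scope.

(* Only n >= 1 is meaningful; B x 0 is the empty sum. *)
Definition B (R : realType) (x : R) (n : nat) : R :=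
  \sum_(1 <= k < n.+1) 1 / k%:R * (Num.floor (k%:R / n%:R * x))%:~R.

(* Main.v *)
Require Import Defs.
From mathcomp Require Import all_boot all_order all_algebra.
From mathcomp Require Import all_classical all_reals all_analysis.
From mathcomp Require Import ring lra.

(** Write N for the integer part of [x].  For k <= n the number k x / n is
    at most [x], so its integer part counts the j in {1, ..., N} with
    j <= k x / n, that is with n j / x <= k ([floor_count]).  Exchanging the
    two sums gives
      B_n(x) = sum_{1 <= j <= N} sum_{n j / x <= k <= n} 1 / k.
    Each inner sum is a section of the harmonic series from t = n j / x to n.
    Comparing 1 / k with increments of the logarithm shows that it differs
    from ln (n / t) = ln (x / j) by at most 1 / t = (x / j) / n
    ([harmonic_section_approx]).  The number N of inner sums does not depend
    on n, so the total error is O(1 / n). *)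

Import Order.TTheory GRing.Theory Num.Theory.
Import numFieldNormedType.Exports.
Local Open Scope classical_set_scope.
Local Open Scope ring_scope.

Lemma floor_count (R : realType) (u : R) (N : nat) :
  0 <= u -> u < N.+1%:R ->
  (Num.floor u)%:~R = \sum_(1 <= j < N.+1 | j%:R <= u) 1 :> R.
Proof.
move=> u0 uN.
under eq_bigl do rewrite -truncn_ge_nat//.
have fE : Num.floor u = Num.truncn u :> int.
  by rewrite truncn_floor u0 gez0_abs// floor_ge0.
have : (Num.truncn u <= N)%N by rewrite truncn_le_nat.
rewrite fE; move: (Num.truncn u) => m mN.
rewrite (big_cat_nat (n := m.+1))//=.
rewrite [X in _ + X]big_nat_cond [X in _ + X]big_pred0; last first.
  by move=> j; case: (ltnP m j) => //=; rewrite andbF.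
rewrite addr0 big_nat_cond (eq_bigl (fun j => (1 <= j < m.+1)%N && true)).
  by rewrite -big_nat_cond sumr_const_nat subn1 -pmulrn.
by move=> j; rewrite !ltnS; case: (j <= m)%N; rewrite ?andbF ?andbT.
Qed.

Lemma lnB_le (R : realType) (a b : R) :
  0 < a -> 0 < b -> ln b - ln a <= b / a - 1.
Proof.
move=> a0 b0; rewrite -ln_div ?posrE//.
have ba0 : 0 < b / a by rewrite divr_gt0.
have := @le_ln1Dx R (b / a - 1).
rewrite subrKC; apply; lra.
Qed.

(** Each term is caught between two increments of the logarithm:
    ln (k + 1) - ln k <= 1 / k, and 1 / k <= ln k - ln (k - 1) when k > 1.
    Summing the upper bounds over all terms but the first, which is itself
    at most 1 / t, gives ln (n / t) + 1 / t.  Summing the lower bounds gives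
    at least ln ((n + 1) / (t + 1)), because the section starts before t + 1;
    this is again within 1 / t of ln (n / t). *)
Lemma harmonic_section_approx (R : realType) (t : R) (n : nat) :
  0 < t -> t <= n%:R ->
  `|\sum_(1 <= k < n.+1 | t <= k%:R) k%:R^-1 - ln (n%:R / t)| <= t^-1.
Proof.
move=> t0 tn.
have n0 : 0 < n%:R :> R by exact: lt_le_trans tn.
set S := fun m : nat => \sum_(1 <= k < m.+1 | t <= k%:R) k%:R^-1 : R.
rewrite -/(S n).
have S0 : S 0%N = 0 by rewrite /S big_geq.
have Srec m : S m.+1 = S m + if t <= m.+1%:R then m.+1%:R^-1 else 0.
  by rewrite /S [LHS]big_mkcond big_nat_recr//= -big_mkcond.
clearbody S.
have small m : m%:R < t -> S m = 0.
  elim: m => // m IH mt; rewrite Srec IH ?add0r ?leNgt ?mt//.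
  by apply: le_lt_trans mt; rewrite ler_nat.
have upper m : t <= m%:R -> S m <= ln m%:R - ln t + t^-1.
  elim: m => [|m IH] tm; first by rewrite leNgt t0 in tm.
  rewrite Srec ifT//; have [tm'|mt] := leP t m%:R.
    have m0 : 0 < m%:R :> R by exact: lt_le_trans tm'.
    have := @lnB_le R m.+1%:R m%:R (ltr0Sn _ _) m0.
    have -> : m%:R / m.+1%:R - 1 = - m.+1%:R^-1 :> R.
      by rewrite -natr1; field; rewrite natr1 pnatr_eq0.
    have := IH tm'; move: m.+1%:R^-1 => a; lra.
  have : ln t <= ln m.+1%:R :> R by rewrite ler_ln ?posrE.
  have : m.+1%:R^-1 <= t^-1 by rewrite lef_pV2 ?posrE.
  rewrite small//; move: m.+1%:R^-1 => a; lra.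
(* For m < t the sum is empty and the left-hand side is nonpositive, so the
   induction can start at 0. *)
have lower m : ln m.+1%:R - ln (t + 1) <= S m.
  have t1 : 0 < t + 1 by lra.
  elim: m => [|m IH].
    by rewrite S0 subr_le0 ler_ln ?posrE// lerDr ltW.
  rewrite Srec; case: ifP => [tm|/negbT].
    have := @lnB_le R m.+1%:R m.+2%:R (ltr0Sn _ _) (ltr0Sn _ _).
    have -> : m.+2%:R / m.+1%:R - 1 = m.+1%:R^-1 :> R.
      by rewrite -[m.+2%:R]natr1 mulrDl divff ?pnatr_eq0// mul1r addrC addKr.
    move: m.+1%:R^-1 => a; lra.
  rewrite -ltNge => mt; rewrite addr0 small; last first.
    by apply: le_lt_trans mt; rewrite ler_nat.
  by rewrite subr_le0 ler_ln ?posrE// -natr1 lerD2r ltW.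
have lnS : ln n%:R <= ln n.+1%:R :> R.
  by rewrite ler_ln ?posrE// ler_nat.
have lnt : ln (t + 1) - ln t <= t^-1.
  have t1 : 0 < t + 1 by lra.
  have := @lnB_le R t (t + 1) t0 t1.
  by have -> : (t + 1) / t - 1 = t^-1 by field; rewrite gt_eqF.
rewrite ln_div ?posrE// ler_distl; apply/andP; split.
  have := lower n; lra.
have := upper n tn; lra.
Qed.

(** The section from n / y to n keeps the ratio y of its ends, so the error
    bound 1 / t of [harmonic_section_approx] is y / n. *)
Lemma cvg_harmonic_section (R : realType) (y : R) : 1 <= y ->
  \sum_(1 <= k < n.+1 | n%:R <= k%:R * y) k%:R^-1 @[n --> \oo] --> ln y.
Proof.
move=> y1; have y0 : 0 < y by exact: lt_le_trans y1.
rewrite -cvg_shiftS /=.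
have err0 : y * harmonic n @[n --> \oo] --> (0 : R).
  by rewrite -(mulr0 y); apply: cvgMr; exact: cvg_harmonic.
apply: (@squeeze_cvgr _ _ _ _ (fun n => ln y - y * harmonic n)
                              (fun n => ln y + y * harmonic n)).
- apply: nearW => n; rewrite -ler_distl.
  have n0 : 0 < n.+1%:R :> R by rewrite ltr0Sn.
  have t0 : 0 < n.+1%:R / y by rewrite divr_gt0.
  have tn : n.+1%:R / y <= n.+1%:R by rewrite ler_pdivrMr// ler_peMr// ltW.
  have := @harmonic_section_approx R _ _ t0 tn.
  under [in X in _ -> X]eq_bigl do rewrite -ler_pdivrMr//.
  by rewrite !invf_div mulrCA divff ?gt_eqF// mulr1.
- by rewrite -[X in _ --> X]subr0; apply: cvgB => //; exact: cvg_cst.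
- by rewrite -[X in _ --> X]addr0; apply: cvgD => //; exact: cvg_cst.
Qed.

Theorem theorem1 (R : realType) (x : R) (hx : 0 <= x) :
  B x n @[n --> \oo] --> \sum_(1 <= k < `|Num.floor x|%N.+1) ln (x / k%:R).
Proof.
set N := `|Num.floor x|%N.
have NE : N = Num.truncn x by rewrite truncn_floor hx.
pose S j n : R := \sum_(1 <= k < n.+1 | n%:R <= k%:R * (x / j%:R)) k%:R^-1.
have BE n : B x n.+1 = \sum_(1 <= j < N.+1 | (1 <= j < N.+1)%N) S j n.+1.
  have n0 : 0 < n.+1%:R :> R by rewrite ltr0Sn.
  rewrite -big_nat /B.
  under [LHS]eq_big_nat => k /andP[k1 kn].
    have u0 : 0 <= k%:R / n.+1%:R * x by rewrite mulr_ge0// divr_ge0.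
    have uN : k%:R / n.+1%:R * x < N.+1%:R.
      rewrite (@le_lt_trans _ _ x)//; last by rewrite NE truncnS_gt.
      by rewrite ler_piMl// ler_pdivrMr// mul1r ler_nat.
    rewrite (floor_count _ _ _ u0 uN) mulr_sumr.
    under eq_bigr do rewrite mul1r mulr1.
  over.
  rewrite (exchange_big_dep_nat xpredT)//=.
  apply: eq_big_nat => j /andP[j1 jN]; apply: eq_bigl => k.
  have j0 : 0 < j%:R :> R by rewrite ltr0n.
  by rewrite mulrAC ler_pdivlMr// mulrA ler_pdivlMr// mulrC.
(* Keep the range of j as a condition: it gives x / j >= 1 below. *)
rewrite big_nat -cvg_shiftS (eq_cvg _ _ BE).
apply: cvg_big => [|j /andP[j1 jN]]; first exact: add_continuous.
have j0 : 0 < j%:R :> R by rewrite ltr0n.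
rewrite (cvg_shiftS (S j)); apply: cvg_harmonic_section.
by rewrite ler_pdivlMr// mul1r -truncn_ge_nat// -NE.
Qed.
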